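(* Let $\mathbf A\in\mathbb R^{n\times d}$ have rank $d$ and rows $\mathbf a_1,\dots,\mathbf a_n$, and let $\mathbf p\in\Delta_n$ with $\mathbf M(\mathbf p)\succ0$. Then: (a) $\nabla f(\mathbf p)_i=-v_i(\mathbf p)$ for every $i$. (b) $\sum_ip_iv_i(\mathbf p)=d$; hence $\max_iv_i(\mathbf p)\ge d$, with equality iff $\mathbf p$ is optimal (i.e. minimizes $f$ over $\Delta_n$). (c) The Frank--Wolfe gap $g(\mathbf p):=\max_{\mathbf q\in\Delta_n}\langle-\nabla f(\mathbf p),\mathbf q-\mathbf p\rangle$ equals $\max_iv_i(\mathbf p)-d$, satisfies $g(\mathbf p)\ge f(\mathbf p)-f^\star\ge0$, and $f(\mathbf p)-f^\star\le d\log(1+g(\mathbf p)/d)\le g(\mathbf p)$. Thus $\max_iv_i(\mathbf p)\le(1+\varepsilon)d$ is equivalent to $g(\mathbf p)\le\varepsilon d$. (d) $\nabla^2f(\mathbf p)_{ij}=(\mathbf a_i^\top\mathbf M(\mathbf p)^{-1}\mathbf a_j)^2$, the Gram matrix (in the trace inner product) of the matrices $(\mathbf M(\mathbf p)^{-1/2}\mathbf a_i)(\mathbf M(\mathbf p)^{-1/2}\mathbf a_i)^\top$, $i\in[n]$; it is positive semidefinite of rank at most $\binom{d+1}2$, with kernel $\{\boldsymbol\delta\in\mathbb R^n:\sum_i\delta_i\mathbf a_i\mathbf a_i^\top=0\}$, independent of $\mathbf p$. More precisely, for every $\boldsymbol\delta\in\mathbb R^n$, $$\boldsymbol\delta^\top\nabla^2f(\mathbf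 p)\boldsymbol\delta=\Big\|\mathbf M(\mathbf p)^{-1/2}\Big(\sum_i\delta_i\mathbf a_i\mathbf a_i^\top\Big)\mathbf M(\mathbf p)^{-1/2}\Big\|_F^2.$$
   Context: For $\mathbf p\in\mathbb R^n$, $\mathbf M(\mathbf p)=\sum_ip_i\mathbf a_i\mathbf a_i^\top$; when $\mathbf M(\mathbf p)\succ0$, $v_i(\mathbf p)=\mathbf a_i^\top\mathbf M(\mathbf p)^{-1}\mathbf a_i$ and $f(\mathbf p)=-\log\det\mathbf M(\mathbf p)$ (gradient and Hessian are taken on the open set $\{\mathbf M\succ0\}\subset\mathbb R^n$). $\Delta_n=\{\mathbf p\ge0:\sum_ip_i=1\}$ and $f^\star=\min_{\Delta_n}f$, with $f=+\infty$ where $\mathbf M$ is singular. *)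

(* Defs.v *)
From mathcomp Require Import all_boot all_order all_algebra.
From mathcomp Require Import all_classical all_reals all_analysis.
Import Order.TTheory GRing.Theory Num.Theory.
Import numFieldNormedType.Exports.

Set Implicit Arguments.
Unset Strict Implicit.
Unset Printing Implicit Defensive.

Local Open Scope classical_set_scope.
Local Open Scope ring_scope.

Section Matrices.
Context {R : realType}.

Definition pdmx d (M : 'M[R]_d) : Prop :=
  M^T = M /\ forall x : 'cV[R]_d, x != 0 -> 0 < (x^T *m M *m x) 0 0.

Definition psdmx d (M : 'M[R]_d) : Prop :=
  M^T = M /\ forall x : 'cV[R]_d, 0 <= (x^T *m M *m x) 0 0.

(* The unique positive semidefinite square root of a positive semidefinite
   matrix; the junk value [0] is taken only when there is none. *)
Definition sqrtmx d (M : 'M[R]_d) : 'M[R]_d :=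
  xget 0 [set S | psdmx S /\ S *m S = M].

Definition invsqrtmx d (M : 'M[R]_d) : 'M[R]_d := sqrtmx (invmx M).

Definition trdot d (X Y : 'M[R]_d) : R := \tr (X^T *m Y).

Definition frobnorm d (X : 'M[R]_d) : R :=
  Num.sqrt (\sum_i \sum_j X i j ^+ 2).

Definition dotv n (u v : 'rV[R]_n) : R := \sum_i u 0 i * v 0 i.

End Matrices.

Section Calculus.
Context {R : realType} {n : nat}.

(* Entries are directional derivatives, hence meaningful only where the
   function is (twice) differentiable. *)
Definition gradient (f : 'rV[R]_n -> R) (p : 'rV[R]_n) : 'rV[R]_n :=
  \row_i 'D_(delta_mx 0 i) f p.

Definition hessian (f : 'rV[R]_n -> R) (p : 'rV[R]_n) : 'M[R]_n :=
  \matrix_(i, j) 'D_(delta_mx 0 i) (fun q => 'D_(delta_mx 0 j) f q) p.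

End Calculus.

Definition is_max {R : realType} (S : set R) (m : R) : Prop :=
  S m /\ ubound S m.

Section DOptimalDesign.
Context {R : realType} {n d : nat}.
Implicit Types (A : 'M[R]_(n, d)) (p : 'rV[R]_n).

Definition simplex : set 'rV[R]_n :=
  [set p | (forall i, 0 <= p 0 i) /\ \sum_i p 0 i = 1].

Definition design_row A (i : 'I_n) : 'cV[R]_d := (row i A)^T.

Definition info A p : 'M[R]_d :=
  \sum_i p 0 i *: (design_row A i *m (design_row A i)^T).

Definition leverage A p (i : 'I_n) : R :=
  ((design_row A i)^T *m invmx (info A p) *m design_row A i) 0 0.

Definition max_leverage A p : R := sup (range (leverage A p)).

(* Real-valued objective, meaningful on the open set where [info A p] is
   positive definite; this is the function that is differentiated. *)
Definition objective A p : R := - ln (\det (info A p)).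

(* On the simplex [info A p] is positive semidefinite, so that it is
   invertible exactly when it is positive definite. *)
Definition ext_objective A p : \bar R :=
  if info A p \in unitmx then (objective A p)%:E else +oo%E.

Definition opt_value A : \bar R := ereal_inf (ext_objective A @` simplex).

Definition optimal A p : Prop :=
  simplex p /\
  forall q, simplex q -> (ext_objective A p <= ext_objective A q)%E.

Definition fw_values A p : set R :=
  [set dotv (- gradient (objective A) p) (q - p) | q in simplex].

Definition fw_gap A p : R := sup (fw_values A p).

Definition hessian_kernel A p : set 'rV[R]_n :=
  [set delta | hessian (objective A) p *m delta^T = 0].

Definition whitened A p (i : 'I_n) : 'M[R]_d :=
  let w := invsqrtmx (info A p) *m design_row A i in w *m w^T.

End DOptimalDesign.

(* Main.v *)
Require Import Defs.
From mathcomp Require Import all_boot all_order perm all_algebra.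
From mathcomp Require Import all_classical all_reals all_analysis.
From mathcomp Require Import complex.
Import Order.TTheory GRing.Theory Num.Theory.
Import numFieldNormedType.Exports.

(* By the matrix determinant lemma [det M(p)] is affine along each coordinate
   direction with relative slope [v_i], which gives the gradient, and the
   Sherman-Morrison formula differentiates [v_j] once more, which gives the
   Hessian.  For [q] in the simplex, AM-GM applied to the eigenvalues of
   [M(p)^(-1/2) M(q) M(p)^(-1/2)], whose trace [sum_i q_i v_i(p)] is at most
   [max_i v_i(p)], bounds [f(p) - f(q)] by [d log(1 + g(p)/d)].  So
   [max_i v_i(p) = d] forces optimality; conversely, if [v_i(p) > d] then [f]
   decreases from [p] towards the vertex [e_i].  The real spectral facts
   (square roots, determinant and trace of a positive semidefinite matrix)
   are pulled back from the spectral theorem over [R[i]]. *)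

Set Implicit Arguments.
Unset Strict Implicit.
Unset Printing Implicit Defensive.

Local Open Scope classical_set_scope.
Local Open Scope ring_scope.

(** Newton interpolation: each new node is corrected by a multiple of the product over the earlier
    nodes, which vanishes on all of them. Nodes may repeat, as eigenvalues do. *)
Lemma exists_interpolant (F : fieldType) (f : F -> F) (s : seq F) :
  exists q : {poly F}, {in s, forall x, q.[x] = f x}.
Proof.
elim: s => [|a s [q qE]]; first by exists 0.
have [as_|nas] := boolP (a \in s).
  by exists q => x; rewrite inE => /orP[/eqP ->|]; exact: qE.
pose P := \prod_(b <- s) ('X - b%:P).
have Pa : P.[a] != 0 by rewrite -[_ == 0]/(root P a) root_prod_XsubC.
exists (q + ((f a - q.[a]) / P.[a])%:P * P) => x.
rewrite inE !hornerE => /orP[/eqP ->|xs]; first by rewrite divfK// subrKC.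
have /eqP -> : P.[x] == 0 by rewrite -[_ == 0]/(root P x) root_prod_XsubC.
by rewrite mulr0 addr0 qE.
Qed.

(** * Positive semidefinite real matrices *)

Section RealSpectral.
Context {R : realType}.
Local Notation C := (R[i]).
Local Notation toC := (real_complex R).
Implicit Types d : nat.

Lemma row_normsq_gt0 d (v : 'rV[R]_d) : v != 0 -> 0 < (v *m v^T) 0 0.
Proof.
move=> v0; rewrite mxE.
have [j vj] : exists j, v 0 j != 0.
  apply/existsP; apply: contraNT v0 => /existsPn vj0.
  by apply/eqP/rowP => j; rewrite mxE; apply/eqP; rewrite -[_ == _]negbK vj0.
rewrite (bigD1 j)//= mxE ltr_pwDl//.
  by rewrite -expr2 lt_def sqrf_eq0 vj sqr_ge0.
by apply: sumr_ge0 => k _; rewrite mxE -expr2 sqr_ge0.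
Qed.

(** A real symmetric matrix is Hermitian over [R[i]], so its spectrum is real and can be recorded by
    real parts; only [P] remains complex. *)
Lemma sym_diagonalization d (M : 'M[R]_d) : M^T = M ->
  exists (P : 'M[C]_d) (lam : 'rV[R]_d), P \in unitmx /\
    map_mx toC M = invmx P *m diag_mx (map_mx toC lam) *m P.
Proof.
move=> symM.
have hM : map_mx toC M \is hermsymmx.
  apply/is_hermitianmxP; rewrite expr0 scale1r.
  apply/matrixP=> i j; rewrite !mxE -[in LHS]symM mxE.
  by rewrite /Num.conj /= oppr0.
exists (spectralmx (map_mx toC M)).
have /mxOverP re := hermitian_spectral_diag_real hM.
exists (\row_j complex.Re (spectral_diag (map_mx toC M) 0 j)).
split; first exact: spectral_unit.
have /orthomx_spectralP {1}-> := hermitian_normalmx hM.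
congr (_ *m diag_mx _ *m _); apply/rowP => j; rewrite !mxE.
by have := re 0 j; move=> /RRe_real.
Qed.

Lemma psd_diagonalization d (M : 'M[R]_d) : psdmx M ->
  exists (P : 'M[C]_d) (lam : 'rV[R]_d), [/\ P \in unitmx,
    map_mx toC M = invmx P *m diag_mx (map_mx toC lam) *m P &
    forall j, 0 <= lam 0 j].
Proof.
move=> [symM psdM]; have [P [lam [uP ME]]] := sym_diagonalization symM.
exists P, lam; split => // j.
(* Row [j] of [P] is a complex left eigenvector, nonzero because [P] is invertible. Being an
   eigenvalue descends to [R], so a real eigenvector [v] exists and [v M v^T = lam_j v v^T] gives
   the sign. *)
have /eigenvalueP[v vM v0] : eigenvalue M (lam 0 j).
  rewrite -(eigenvalue_map toC); apply/eigenvalueP; exists (row j P).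
    rewrite ME -row_mul !mulmxA mulmxV// mul1mx.
    by rewrite row_mul row_diag_mx -scalemxAl -rowE mxE.
  apply/eqP => rj0; have := congr1 (row j) (mulmxV uP).
  by rewrite row_mul rj0 mul0mx => /rowP/(_ j)/eqP; rewrite !mxE eqxx eq_sym oner_eq0.
have := psdM v^T; rewrite trmxK vM -scalemxAl mxE pmulr_lge0//.
exact: row_normsq_gt0.
Qed.

(* The square root is a polynomial in [M], hence real.  Interpolating fourth
   roots rather than square roots makes [S] the square of a symmetric matrix,
   so that it is positive semidefinite. *)
Lemma psd_sqrt_exists d (M : 'M[R]_d) : psdmx M ->
  exists S : 'M[R]_d, psdmx S /\ S *m S = M.
Proof.
(* [horner_mx] is stated for matrices of positive size, so the empty matrix is treated apart. *)
case: d M => [|d] M psdM.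
  exists M; split => //; apply/matrixP; by case.
have [P [lam [uP ME lam0]]] := psd_diagonalization psdM.
have [symM _] := psdM.
have [q qE] := exists_interpolant (fun x => Num.sqrt (Num.sqrt x))
  [seq lam 0 j | j <- enum 'I_d.+1].
have tr_horner : (horner_mx M q)^T = horner_mx M q.
  elim/poly_ind: q {qE} => [|q c IH]; first by rewrite rmorph0 trmx0.
  rewrite rmorphD rmorphM /= horner_mx_X horner_mx_C linearD /= tr_scalar_mx.
  rewrite -[_ * _]/(_ *m _) trmx_mul symM IH; congr (_ + _).
  by have := comm_mx_horner q (comm_mx_refl M).
pose T := horner_mx M q; have trT : T^T = T := tr_horner.
exists (T *m T); split; first split.
- by rewrite trmx_mul trT.
- move=> x; rewrite mulmxA -{1}trT -trmx_mul -mulmxA.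
  set y := T *m x; rewrite mxE sumr_ge0// => k _.
  by rewrite mxE -expr2 sqr_ge0.
apply: (@map_mx_inj _ _ toC).
have -> : T *m T *m (T *m T) = horner_mx M (q ^+ 4).
  by rewrite rmorphXn/= /T 3!exprS expr1 -!mulmxA.
rewrite map_horner_mx ME horner_mx_uconjC// horner_mx_diag.
congr (_ *m diag_mx _ *m _); apply/rowP => j; rewrite !mxE.
rewrite horner_map horner_exp qE; last by rewrite map_f// mem_enum.
by rewrite (exprM _ 2 2) !sqr_sqrtr// sqrtr_ge0.
Qed.

(** Both identities are checked over [R[i]], where the conjugation by [P] cancels, and pulled back
    along the injective embedding. *)
Lemma psd_det_trace d (M : 'M[R]_d) : psdmx M ->
  exists lam : 'rV[R]_d, [/\ forall j, 0 <= lam 0 j,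
    \det M = \prod_j lam 0 j & \tr M = \sum_j lam 0 j].
Proof.
move=> /psd_diagonalization[P [lam [uP ME lam0]]]; exists lam; split => //.
- apply: (fmorph_inj toC); rewrite -det_map_mx ME !det_mulmx mulrAC -det_mulmx.
  rewrite mulVmx// det1 mul1r det_diag rmorph_prod.
  by apply: eq_bigr => j _; rewrite mxE.
- apply: (fmorph_inj toC); rewrite -trace_map_mx ME mxtrace_mulC mulmxA mulmxV//.
  by rewrite mul1mx mxtrace_diag rmorph_sum; apply: eq_bigr => j _; rewrite mxE.
Qed.

Lemma det_psd_ge0 d (M : 'M[R]_d) : psdmx M -> 0 <= \det M.
Proof. by move=> /psd_det_trace[lam [lam0 -> _]]; exact: prodr_ge0. Qed.

Lemma det_le_trace_pow d (M : 'M[R]_d) : psdmx M ->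
  \det M <= (\tr M / d%:R) ^+ d.
Proof.
move=> /psd_det_trace[lam [lam0 -> ->]].
have [] := leif_AGM (A := predT) (E := lam 0) (fun i _ => lam0 i).
by rewrite cardT size_enum_ord.
Qed.

End RealSpectral.

(** * Rank-one updates of determinants and inverses *)

Lemma det_add1_rank1 (R : comNzRingType) d (u : 'cV[R]_d) (v : 'rV[R]_d) :
  \det (1%:M + u *m v) = 1 + (v *m u) 0 0.
Proof.
(* Two block-triangular factorizations of one matrix; the unipotent factors have determinant 1, so
   comparing determinants leaves the claim. *)
have E : block_mx 1%:M 0 v 1%:M *m block_mx (1%:M + u *m v) u 0 1%:M
   = block_mx 1%:M u 0 (1%:M + v *m u) *m block_mx 1%:M 0 v (1%:M : 'M[R]_1).
  rewrite !mulmx_block !(mul0mx, mulmx0, mul1mx, mulmx1, addr0, add0r).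
  by rewrite mulmxDr mulmxDl mulmx1 mul1mx mulmxA [v + _]addrC [X in block_mx _ _ _ X]addrC.
have := congr1 determinant E.
rewrite !det_mulmx !det_lblock !det_ublock !det1 !(mul1r, mulr1) => ->.
by rewrite det_mx11 !mxE.
Qed.

Lemma det_add_rank1 (F : fieldType) d (M : 'M[F]_d) (u : 'cV[F]_d)
    (v : 'rV[F]_d) : M \in unitmx ->
  \det (M + u *m v) = \det M * (1 + (v *m invmx M *m u) 0 0).
Proof.
move=> uM; rewrite -mulmxA -det_add1_rank1 -det_mulmx mulmxDr mulmx1.
by rewrite mulmxA mulKVmx// -mulmxA.
Qed.

Lemma invmx_add_rank1 (F : fieldType) d (M : 'M[F]_d) (u : 'cV[F]_d)
    (v : 'rV[F]_d) (c := 1 + (v *m invmx M *m u) 0 0) :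
  M \in unitmx -> c != 0 ->
  invmx (M + u *m v)
  = invmx M - c^-1 *: (invmx M *m u *m (v *m invmx M)).
Proof.
move=> uM c0; set N := invmx M.
have E : (M + u *m v) *m (N - c^-1 *: (N *m u *m (v *m N))) = 1%:M.
  rewrite mulmxBr -scalemxAr !mulmxDl mulmxV// !mulmxA mulmxV// mul1mx.
  (* The inner factor [v *m N *m u] is the scalar [c - 1], so all correction terms are multiples of
     [u *m v *m N] and cancel. *)
  have -> : u *m v *m N *m u *m v *m N = (c - 1) *: (u *m v *m N).
    have -> : u *m v *m N *m u = (c - 1) *: u.
      rewrite -2!mulmxA (mulmxA v) [v *m N *m u in LHS]mx11_scalar mul_mx_scalar.
      by rewrite /c addrC addKr.
    by rewrite -!scalemxAl.
  rewrite -[X in _ *: (X + _)]scale1r -scalerDl subrKC scalerA mulVf// scale1r.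
  by rewrite addrK.
have [uMuv _] := mulmx1_unit E.
by rewrite -[LHS]mulmx1 -E mulKmx.
Qed.

(** * Differentiability *)

Section Differentiability.
Context {R : realType} {V W : normedModType R}.

(** Differentiability is local: [g - f] vanishes near [x], hence is negligible there and has
    differential zero. *)
Lemma near_eq_differentiable (f g : V -> W) (x : V) :
  (\forall y \near x, f y = g y) -> differentiable f x -> differentiable g x.
Proof.
move=> fg df.
suff de : differentiable (g - f) x.
  by have := differentiableD df de; rewrite addrC subrK.
have near0 : \forall h \near (0 : V), (g - f) (h + x) = 0.
  move: fg; rewrite (near_shift 0) /= subr0.
  by apply: filterS => h /= fgh; rewrite !fctE -fgh subrr.
have ex0 : (g - f) x = 0 by have := nbhs_singleton near0; rewrite add0r.
have e0 : (g - f) \o shift x = cst ((g - f) x) + \0 +o_ (0 : V) id.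
  rewrite ex0; apply/eqaddoP => _/posnumP[eps].
  move: near0; apply: filterS => h /= h0.
  by move: h0; rewrite !fctE => ->; rewrite addr0 subr0 normr0 mulr_ge0.
(* ['d] is a chosen linear map; uniqueness of the differential identifies it with zero. *)
have dE : 'd (g - f) x = \0 :> (V -> W).
  by apply: diff_unique e0 => y; exact: cst_continuous.
by apply/diff_locallyP; rewrite dE; split => // y; exact: cst_continuous.
Qed.

Lemma differentiable_bigsum (I : Type) (r : seq I) (P : pred I)
    (f : I -> V -> W) (x : V) : (forall i, P i -> differentiable (f i) x) ->
  differentiable (fun y => \sum_(i <- r | P i) f i y) x.
Proof.
move=> df; rewrite (_ : (fun _ => _) = \sum_(i <- r | P i) f i); last first.
  by rewrite fct_sumE.
apply: (big_ind (fun g => differentiable g x)) => //.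
by move=> g h dg dh; exact: differentiableD.
Qed.

End Differentiability.

Section ScalarDifferentiability.
Context {R : realType}.

Lemma differentiable_bigprod (V : normedModType R) (I : Type) (r : seq I) (P : pred I)
    (f : I -> V -> R) (x : V) : (forall i, P i -> differentiable (f i) x) ->
  differentiable (fun y => \prod_(i <- r | P i) f i y) x.
Proof.
move=> df; rewrite (_ : (fun _ => _) = \prod_(i <- r | P i) f i); last first.
  by rewrite fct_prodE.
apply: (big_ind (fun g => differentiable g x)) => //.
by move=> g h dg dh; exact: differentiableM.
Qed.

(** The Leibniz expansion is a finite sum of signed products of entries. *)
Lemma differentiable_det (V : normedModType R) d (F : V -> 'M[R]_d) (x : V) :
  (forall i j, differentiable (fun y => F y i j) x) ->
  differentiable (fun y => \det (F y)) x.
Proof.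
move=> dF.
apply: (@differentiable_bigsum _ V R _ _ _
  (fun (s : {perm 'I_d}) y => (-1) ^+ s * \prod_i F y i (s i))) => s _.
apply: differentiableM; first exact: differentiable_cst.
exact: differentiable_bigprod.
Qed.

End ScalarDifferentiability.

Lemma differentiable_row (R : realType) (V : normedModType R) n
    (f : 'I_n -> V -> R) (x : V) : (forall i, differentiable (f i) x) ->
  differentiable (fun y => \row_i f i y) x.
Proof.
move=> df.
rewrite (_ : (fun _ => _) =
    (fun y => \sum_i f i y *: (delta_mx 0 i : 'rV[R]_n))); last first.
  by apply/funext => y; rewrite [LHS]row_sum_delta; apply: eq_bigr => i _; rewrite mxE.
by apply: differentiable_bigsum => i _; exact: differentiableZl.
Qed.

(** * The objective and its derivatives *)

Section InfoMatrix.
Context {R : realType} {n d : nat}.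
Variable A : 'M[R]_(n, d).
Implicit Types p q : 'rV[R]_n.
Local Notation a := (design_row A).

Lemma tr_info p : (info A p)^T = info A p.
Proof.
rewrite /info linear_sum; apply: eq_bigr => i _.
by rewrite linearZ/= trmx_mul trmxK.
Qed.

Lemma psdmx_info p : (forall i, 0 <= p 0 i) -> psdmx (info A p).
Proof.
move=> p0; split; first exact: tr_info.
move=> x; rewrite mulmx_sumr mulmx_suml summxE sumr_ge0// => i _.
rewrite -scalemxAr -scalemxAl mxE mulr_ge0//.
have -> : x^T *m (a i *m (a i)^T) *m x = ((a i)^T *m x)^T *m ((a i)^T *m x).
  by rewrite trmx_mul trmxK !mulmxA.
by rewrite mxE big_ord1 mxE -expr2 sqr_ge0.
Qed.

(** Moving along a coordinate direction is a rank-one update, so directional derivatives reduce to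
    the two rank-one formulas. *)
Lemma info_shift p (h : R) i :
  info A (h *: delta_mx 0 i + p) = info A p + (h *: a i) *m (a i)^T.
Proof.
rewrite /info; under eq_bigr do rewrite !mxE/= scalerDl.
rewrite big_split/= addrC; congr (_ + _).
rewrite (bigD1 i)//= eqxx mulr1 big1 ?addr0 ?scalemxAl// => j /negPf ji.
by rewrite ji mulr0 scale0r.
Qed.

(** Cyclicity of the trace. The case [q = p] yields the sum [d]; general [q] yields the trace in the
    AM-GM bound. *)
Lemma sum_leverage p q :
  \sum_i q 0 i * leverage A p i = \tr (invmx (info A p) *m info A q).
Proof.
rewrite {2}/info mulmx_sumr linear_sum/=; apply: eq_bigr => i _.
rewrite -scalemxAr mxtraceZ mulmxA mxtrace_mulC mulmxA /leverage.
by rewrite /mxtrace big_ord1.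
Qed.

End InfoMatrix.

Lemma sym_form_comm (R : comNzRingType) d (N : 'M[R]_d) (x y : 'cV[R]_d) :
  N^T = N -> (x^T *m N *m y) 0 0 = (y^T *m N *m x) 0 0.
Proof.
move=> symN; rewrite -[in LHS](trmxK (x^T *m N *m y)) mxE.
by rewrite trmx_mul trmx_mul trmxK symN mulmxA.
Qed.

(** A nonzero row in the left kernel would make the quadratic form vanish at its transpose. *)
Lemma pdmx_unit (R : realType) d (M : 'M[R]_d) : pdmx M -> M \in unitmx.
Proof.
move=> [symM pdM]; rewrite -row_free_unit -kermx_eq0; apply/eqP/row_matrixP => i.
rewrite row0; apply/eqP/negPn/negP => v0.
have /pdM : (row i (kermx M))^T != 0 by rewrite trmx_eq0.
by rewrite trmxK -row_mul mulmx_ker row0 mul0mx mxE ltxx.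
Qed.

Lemma det_gt0_unit (R : realType) d (M : 'M[R]_d) : 0 < \det M -> M \in unitmx.
Proof. by move=> M0; rewrite unitmxE unitfE gt_eqF. Qed.

Lemma det_pd_gt0 (R : realType) d (M : 'M[R]_d) : pdmx M -> 0 < \det M.
Proof.
move=> pdM; have := pdmx_unit pdM; rewrite unitmxE unitfE lt_def => -> /=.
apply: det_psd_ge0; case: pdM => symM pdM; split => // x.
have [->|/pdM/ltW//] := eqVneq x 0; by rewrite mulmx0 mxE.
Qed.

Section Calculus.
Context {R : realType} {n d : nat}.
Variable A : 'M[R]_(n, d).
Implicit Types p q : 'rV[R]_n.
Local Notation a := (design_row A).

Lemma differentiable_info_entry p j k : differentiable (fun q => info A q j k) p.
Proof.
rewrite (_ : (fun _ => _) = fun q => \sum_i q 0 i * (a i *m (a i)^T) j k).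
  apply: differentiable_bigsum => i _; apply: differentiableM.
    exact: differentiable_coord.
  exact: differentiable_cst.
by apply/funext => q; rewrite summxE; apply: eq_bigr => i _; rewrite mxE.
Qed.

Lemma differentiable_det_info p : differentiable (fun q => \det (info A q)) p.
Proof. by apply: differentiable_det => j k; exact: differentiable_info_entry. Qed.

(** The derivative formulas are stated under [0 < \det], an open condition by continuity, which
    positive definiteness implies. *)
Lemma near_det_info_gt0 p : 0 < \det (info A p) ->
  \forall q \near p, 0 < \det (info A q).
Proof.
move=> det0; have /differentiable_continuous c := differentiable_det_info p.
exact: cvgr_gt c _ det0.
Qed.

Lemma differentiable_objective p : 0 < \det (info A p) ->
  differentiable (objective A) p.
Proof.
move=> det0; apply: differentiableN.
apply: (differentiable_comp (differentiable_det_info p)).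
by apply/derivable1_diffP; apply: ex_derive; exact: is_derive1_ln.
Qed.

Lemma derive_det_info p i : info A p \in unitmx ->
  'D_(delta_mx 0 i) (fun q => \det (info A q)) p = \det (info A p) * leverage A p i.
Proof.
move=> uM; apply/cvg_lim => //.
(* The determinant is affine in [h], so its difference quotient is constant for [h != 0]. *)
apply: (@cvg_trans _ (cst (\det (info A p) * leverage A p i) @ 0^')); last first.
  exact: cvg_cst.
apply: near_eq_cvg; near=> h.
rewrite /= info_shift det_add_rank1// -scalemxAr mxE.
rewrite mulrDr mulr1 addrAC subrr add0r mulrCA -[_ *: _]/(_ * _) mulKf//.
by near: h; exact: nbhs_dnbhs_neq.
Unshelve. all: by end_near. Qed.

Lemma derive_objective p i : 0 < \det (info A p) ->
  'D_(delta_mx 0 i) (objective A) p = - leverage A p i.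
Proof.
move=> det0.
have dln : differentiable (@ln R) (\det (info A p)).
  by apply/derivable1_diffP; apply: ex_derive; exact: is_derive1_ln.
rewrite deriveE; last exact: differentiable_objective.
have -> : objective A = - (@ln R \o (fun q => \det (info A q))) by [].
rewrite (diffN (differentiable_comp (differentiable_det_info p) dln)).
rewrite fctE (diff_comp (differentiable_det_info p) dln) /=.
rewrite -(deriveE _ (differentiable_det_info p)).
rewrite derive_det_info ?det_gt0_unit// diff1E//=.
rewrite derive1E; have [_ ->] := is_derive1_ln det0.
by rewrite -[_ *: _]/(_ * _) mulrAC mulfV ?mul1r// gt_eqF.
Qed.

Lemma differentiable_leverage p i : 0 < \det (info A p) ->
  differentiable (fun q => leverage A q i) p.
Proof.
move=> det0.
(* By [det_add_rank1], [1 + v_i = det(M + a_i a_i^T) / det M]. *)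
apply: (@near_eq_differentiable _ _ _ (fun q =>
  \det (info A q + a i *m (a i)^T) * (\det (info A q))^-1 - 1)).
  near=> q; have detq0 : 0 < \det (info A q).
    by near: q; exact: near_det_info_gt0.
  rewrite det_add_rank1 ?det_gt0_unit// mulrAC mulfV ?gt_eqF// mul1r.
  by rewrite addrC addKr.
apply: differentiableB; last exact: differentiable_cst.
apply: differentiableM; last first.
  by apply: differentiableV; [exact: differentiable_det_info|rewrite gt_eqF].
apply: differentiable_det => j k.
rewrite (_ : (fun _ => _) =
   (fun q => info A q j k) \+ cst ((a i *m (a i)^T) j k)).
  apply: differentiableD; first exact: differentiable_info_entry.
  exact: differentiable_cst.
by apply/funext => q; rewrite mxE.
Unshelve. all: by end_near. Qed.

Lemma near_gradient_objective p : 0 < \det (info A p) ->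
  \forall q \near p, - (\row_i leverage A q i) = gradient (objective A) q.
Proof.
move=> det0; apply: filterS (near_det_info_gt0 det0) => q detq0.
by apply/rowP => i; rewrite !mxE derive_objective.
Qed.

(** Makes the entrywise directional derivatives in [hessian] a genuine second derivative. *)
Lemma differentiable_gradient_objective p : 0 < \det (info A p) ->
  differentiable (gradient (objective A)) p.
Proof.
move=> det0; apply: near_eq_differentiable (near_gradient_objective det0) _.
apply: differentiableN; apply: differentiable_row => i.
exact: differentiable_leverage.
Qed.

(** Sherman-Morrison with the dependence on [h] explicit, so that the derivative at [h = 0] can be
    read off. *)
Lemma leverage_shift p (h : R) i j (c := 1 + h * leverage A p i) :
  info A p \in unitmx -> c != 0 ->
  leverage A (h *: delta_mx 0 i + p) j
  = leverage A p j
    - c^-1 * h * (((a i)^T *m invmx (info A p) *m a j) 0 0) ^+ 2.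
Proof.
move=> uM c0; set N := invmx (info A p).
have cE : 1 + ((a i)^T *m N *m (h *: a i)) 0 0 = c.
  by rewrite -scalemxAr mxE.
rewrite {1}/leverage info_shift invmx_add_rank1 ?cE// -/N.
have -> : (a j)^T *m (N - c^-1 *: (N *m (h *: a i) *m ((a i)^T *m N))) *m a j
    = (a j)^T *m N *m a j
      - (c^-1 * h) *: ((a j)^T *m N *m a i *m ((a i)^T *m N *m a j)).
  rewrite mulmxBr mulmxBl -!scalemxAr -!scalemxAl -!scalemxAr -!scalemxAl.
  by rewrite scalerA !mulmxA.
rewrite [LHS]mxE [X in _ + X]mxE [X in _ - X]mxE [X in _ * X]mxE big_ord1.
rewrite expr2 /leverage -/N; congr (_ - _ * (_ * _)).
by apply: sym_form_comm; rewrite /N trmx_inv tr_info.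
Qed.

Lemma hessian_objective p i j : 0 < \det (info A p) ->
  hessian (objective A) p i j
  = (((a i)^T *m invmx (info A p) *m a j) 0 0) ^+ 2.
Proof.
move=> det0; rewrite mxE; set u := (_ ^+ 2).
rewrite (@near_eq_derive _ _ _ _ (fun q => - leverage A q j)); last first.
  apply: filterS (near_det_info_gt0 det0) => q detq0.
  exact: derive_objective.
have cc : (1 + h * leverage A p i) @[h --> 0^'] --> 1 + 0 * leverage A p i.
  apply: cvgD; first exact: cvg_cst.
  by apply: cvgM; [exact: nbhs_dnbhs|exact: cvg_cst].
rewrite mul0r addr0 in cc.
(* By [leverage_shift], this is the difference quotient of [- leverage A q j] for small [h != 0]. *)
have cu : (1 + h * leverage A p i)^-1 * u @[h --> 0^'] --> 1^-1 * u.
  apply: cvgM; last exact: cvg_cst.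
  by apply: cvgV cc; exact: oner_neq0.
rewrite invr1 mul1r in cu.
apply/cvg_lim => //.
apply: cvg_trans cu.
apply: near_eq_cvg; near=> h.
have c0 : 1 + h * leverage A p i != 0.
  by rewrite gt_eqF//; near: h; exact: cvgr_gt cc _ ltr01.
have h0 : h != 0 by near: h; exact: nbhs_dnbhs_neq.
rewrite /= leverage_shift ?det_gt0_unit// -/u opprK opprB subrK.
by rewrite -[_ *: _]/(_ * _) [_^-1 * h]mulrC -mulrA mulKf.
Unshelve. all: by end_near. Qed.

End Calculus.

(** * The Hessian as a Gram matrix *)

Section HessianGram.
Context {R : realType}.

Lemma mxrank_sum_rank1 (F : fieldType) m n (I : finType) (P : pred I)
    (u : I -> 'cV[F]_m) (v : I -> 'rV[F]_n) :
  (\rank (\sum_(i | P i) u i *m v i)%R <= #|P|)%N.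
Proof.
rewrite -sum1_card.
apply: (big_ind2 (fun (M : 'M[F]_(m, n)) k => (\rank M <= k)%N)).
- by rewrite mxrank0.
- move=> M1 k1 M2 k2 le1 le2.
  exact: leq_trans (mxrank_add _ _) (leq_add le1 le2).
- by move=> i _; exact: leq_trans (mxrankM_maxl _ _) (rank_leq_col _).
Qed.

(** For each [l] there are [l + 1] admissible [k]; the triangular sum is the binomial. *)
Lemma card_le_pairs d :
  #|[pred kl : 'I_d * 'I_d | (kl.1 <= kl.2)%N]| = 'C(d.+1, 2).
Proof.
rewrite -sum1_card -bin2_sum big_nat_recl// add0n big_mkord.
rewrite -(pair_big_dep (fun _ => true) (fun k l : 'I_d => (k <= l)%N)
  (fun _ _ => 1%N))/=.
rewrite (exchange_big_dep xpredT)//=; apply: eq_bigr => l _.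
rewrite -[LHS]/(\sum_(k < d | (k < l.+1)%N) 1)%N.
by rewrite -(big_ord_widen d (fun=> 1%N)) ?ltn_ord// sum1_card card_ord.
Qed.

(** Folds the lower triangle onto the upper one: weight 1 on the diagonal, 2 above it. *)
Lemma sum_sym_pairs d (f : 'I_d -> 'I_d -> R) : (forall k l, f k l = f l k) ->
  \sum_k \sum_l f k l
  = \sum_(kl : 'I_d * 'I_d | (kl.1 <= kl.2)%N)
      (1 + (kl.1 < kl.2)%N%:R) * f kl.1 kl.2.
Proof.
move=> symf; rewrite pair_big/= (bigID (fun kl : 'I_d * 'I_d => (kl.1 <= kl.2)%N))/=.
under [RHS]eq_bigr do rewrite mulrDl mul1r.
rewrite big_split/=; congr (_ + _).
rewrite (reindex (fun kl : 'I_d * 'I_d => (kl.2, kl.1)))/=; last first.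
  by exists (fun kl => (kl.2, kl.1)) => -[].
rewrite big_mkcond [RHS]big_mkcond/=; apply: eq_bigr => -[k l] _ /=.
rewrite -ltnNge symf; case: ltngtP => //= _; rewrite ?mul1r ?mul0r//.
Qed.

Lemma trdotE d (X Y : 'M[R]_d) : trdot X Y = \sum_i \sum_j X i j * Y i j.
Proof.
rewrite /trdot /mxtrace exchange_big; apply: eq_bigr => j _.
by rewrite mxE; apply: eq_bigr => i _; rewrite mxE.
Qed.

Lemma frobnorm_sq d (X : 'M[R]_d) : frobnorm X ^+ 2 = trdot X X.
Proof.
rewrite trdotE sqr_sqrtr.
  by apply: eq_bigr => i _; apply: eq_bigr => j _; rewrite expr2.
by apply: sumr_ge0 => i _; apply: sumr_ge0 => j _; exact: sqr_ge0.
Qed.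

Lemma trdot_eq0 d (X : 'M[R]_d) : trdot X X = 0 -> X = 0.
Proof.
rewrite trdotE => /eqP; rewrite psumr_eq0; last first.
  by move=> i _; apply: sumr_ge0 => j _; rewrite -expr2 sqr_ge0.
move=> /allP X0; apply/matrixP => i j; rewrite mxE.
have := X0 i (mem_index_enum _); rewrite /= psumr_eq0; last first.
  by move=> k _; rewrite -expr2 sqr_ge0.
by move=> /allP/(_ j (mem_index_enum _)); rewrite /= -expr2 sqrf_eq0 => /eqP.
Qed.

Lemma trdot_sum d n (W : 'I_n -> 'M[R]_d) (x : 'rV[R]_n) :
  trdot (\sum_i x 0 i *: W i) (\sum_i x 0 i *: W i)
  = (x *m (\matrix_(i, j) trdot (W i) (W j)) *m x^T) 0 0.
Proof.
rewrite /trdot.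
have -> : (\sum_i x 0 i *: W i)^T = \sum_i x 0 i *: (W i)^T.
  by rewrite linear_sum; apply: eq_bigr => i _; rewrite linearZ.
rewrite mulmx_suml linear_sum/= [RHS]mxE.
under [RHS]eq_bigr do rewrite mxE big_distrl/=.
rewrite [RHS]exchange_big/=; apply: eq_bigr => i _.
rewrite mulmx_sumr linear_sum/=; apply: eq_bigr => j _.
rewrite !mxE -scalemxAl -scalemxAr !mxtraceZ.
by rewrite mulrCA mulrC.
Qed.

Lemma mxrank_sym_gram d n (W : 'I_n -> 'M[R]_d) : (forall i, (W i)^T = W i) ->
  (\rank (\matrix_(i, j) trdot (W i) (W j))%R <= 'C(d.+1, 2))%N.
Proof.
move=> symW; rewrite -card_le_pairs.
(* Each matrix position contributes a rank-one term; symmetry merges [(k, l)] with [(l, k)], leaving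
   one term per unordered pair. *)
have -> : \matrix_(i, j) trdot (W i) (W j) =
    \sum_(kl : 'I_d * 'I_d | (kl.1 <= kl.2)%N)
      (\col_i ((1 + (kl.1 < kl.2)%N%:R) * W i kl.1 kl.2))
      *m (\row_j W j kl.1 kl.2).
  apply/matrixP => i j; rewrite mxE trdotE sum_sym_pairs; last first.
    by move=> k l; rewrite -{1}(symW i) -{1}(symW j) !mxE.
  rewrite summxE; apply: eq_bigr => kl _.
  by rewrite [RHS]mxE big_ord1 !mxE mulrA.
exact: mxrank_sum_rank1.
Qed.

End HessianGram.

(** * Whitening by the inverse square root *)

Section Whitening.
Context {R : realType} {d : nat}.
Variable M : 'M[R]_d.
Hypothesis pdM : pdmx M.
Local Notation S := (invsqrtmx M).

Lemma psdmx_invmx : psdmx (invmx M).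
Proof.
have uM := pdmx_unit pdM; case: pdM => symM posM.
split; first by rewrite trmx_inv symM.
move=> x; have -> : x^T *m invmx M *m x = (invmx M *m x)^T *m M *m (invmx M *m x).
  by rewrite trmx_mul trmx_inv symM -!mulmxA mulKVmx.
have [->|/posM/ltW//] := eqVneq (invmx M *m x) 0.
by rewrite mulmx0 mxE.
Qed.

(** Existence of a root ensures that [xget] in [sqrtmx] does not fall back on its default [0]. *)
Lemma invsqrtmxP : psdmx S /\ S *m S = invmx M.
Proof. exact: xgetPex (psd_sqrt_exists psdmx_invmx). Qed.

Lemma tr_invsqrtmx : S^T = S. Proof. by case: invsqrtmxP => -[]. Qed.

Lemma invsqrtmx_sq : S *m S = invmx M. Proof. by case: invsqrtmxP. Qed.

Lemma invsqrtmx_unit : S \in unitmx.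
Proof.
have : S *m (S *m M) = 1%:M.
  by rewrite mulmxA invsqrtmx_sq mulVmx// pdmx_unit.
by move=> /mulmx1_unit[].
Qed.

(** [S *m Q *m S] has the determinant and trace of [invmx M *m Q] but is also positive semidefinite,
    so AM-GM on its eigenvalues applies. *)
Lemma det_mul_inv_le (Q : 'M[R]_d) : psdmx Q ->
  \det (invmx M) * \det Q <= (\tr (invmx M *m Q) / d%:R) ^+ d.
Proof.
move=> [symQ psdQ].
have -> : \det (invmx M) * \det Q = \det (S *m Q *m S).
  by rewrite !det_mulmx -invsqrtmx_sq det_mulmx mulrAC.
have -> : \tr (invmx M *m Q) = \tr (S *m Q *m S).
  by rewrite [RHS]mxtrace_mulC mulmxA invsqrtmx_sq.
apply: det_le_trace_pow; split.
  by rewrite !trmx_mul symQ tr_invsqrtmx mulmxA.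
move=> x; have -> : x^T *m (S *m Q *m S) *m x = (S *m x)^T *m Q *m (S *m x).
  by rewrite trmx_mul tr_invsqrtmx !mulmxA.
exact: psdQ.
Qed.

End Whitening.

Section Curvature.
Context {R : realType} {n d : nat}.
Variables (A : 'M[R]_(n, d)) (p : 'rV[R]_n).
Hypothesis pd_p : pdmx (info A p).
Local Notation a := (design_row A).
Local Notation H := (hessian (objective A) p).
Local Notation S := (invsqrtmx (info A p)).

Lemma tr_whitened i : (whitened A p i)^T = whitened A p i.
Proof. by rewrite /whitened trmx_mul trmxK. Qed.

(** The trace of [w_i w_i^T w_j w_j^T] is [(w_i^T w_j)^2], and the two roots between [a_i] and [a_j]
    multiply to the inverse. *)
Lemma trdot_whitened i j : trdot (whitened A p i) (whitened A p j)
  = ((a i)^T *m invmx (info A p) *m a j) 0 0 ^+ 2.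
Proof.
rewrite /trdot tr_whitened /whitened; set wi := _ *m a i; set wj := _ *m a j.
have -> : (a i)^T *m invmx (info A p) *m a j = wi^T *m wj.
  by rewrite trmx_mul tr_invsqrtmx// !mulmxA -(mulmxA _ S S) invsqrtmx_sq.
rewrite -mulmxA mxtrace_mulC mulmxA -mulmxA /mxtrace big_ord1.
clearbody wi wj.
have -> : wi^T *m (wj *m wj^T) *m wi = (wi^T *m wj) *m (wi^T *m wj)^T.
  by rewrite trmx_mul trmxK !mulmxA.
rewrite [wi^T *m wj]mx11_scalar; move: ((wi^T *m wj) 0 0) => c.
by rewrite tr_scalar_mx -scalar_mxM !mxE eqxx !mulr1n.
Qed.

Lemma hessian_gram : H = \matrix_(i, j) trdot (whitened A p i) (whitened A p j).
Proof.
apply/matrixP => i j; rewrite [RHS]mxE trdot_whitened hessian_objective//.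
exact: det_pd_gt0.
Qed.

(** Here [info A x] is taken at an arbitrary direction [x], with entries of any sign. *)
Lemma sum_whitened (x : 'rV[R]_n) :
  \sum_i x 0 i *: whitened A p i = S *m info A x *m S.
Proof.
rewrite mulmx_sumr mulmx_suml; apply: eq_bigr => i _.
by rewrite -scalemxAr -scalemxAl /whitened trmx_mul tr_invsqrtmx// !mulmxA.
Qed.

Lemma hessian_quadratic (x : 'rV[R]_n) :
  (x *m H *m x^T) 0 0 = frobnorm (S *m info A x *m S) ^+ 2.
Proof. by rewrite frobnorm_sq -sum_whitened trdot_sum hessian_gram. Qed.

Lemma psdmx_hessian : psdmx H.
Proof.
split; first by apply/matrixP => i j; rewrite hessian_gram !mxE /trdot -mxtrace_tr trmx_mul trmxK.
by move=> x; have := hessian_quadratic x^T; rewrite trmxK => ->; exact: sqr_ge0.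
Qed.

(** A kernel vector annihilates the quadratic form, hence the Frobenius norm, and the invertible
    root cancels on both sides. Conversely, each entry of the Hessian applied to [x] is a trace
    product with the whitened [info A x]. *)
Lemma hessian_kernelE : hessian_kernel A p = [set x | info A x = 0].
Proof.
apply/seteqP; split => x /= Hx.
  have := hessian_quadratic x; rewrite -mulmxA Hx mulmx0 mxE frobnorm_sq.
  move=> /esym/trdot_eq0 SxS; have uS := invsqrtmx_unit pd_p.
  by rewrite -(mulKmx uS (info A x)) -(mulmxK uS (S *m _)) SxS mul0mx mulmx0.
apply/colP => i; rewrite [RHS]mxE.
transitivity (trdot (whitened A p i) (\sum_j x 0 j *: whitened A p j)).
  rewrite mxE /trdot mulmx_sumr linear_sum/=; apply: eq_bigr => j _.
  by rewrite hessian_gram !mxE -scalemxAr mxtraceZ mulrC.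
by rewrite sum_whitened Hx mulmx0 mul0mx /trdot mulmx0 mxtrace0.
Qed.

End Curvature.

(** * Optimality and the Frank-Wolfe gap *)

Lemma is_max_sup (R : realType) (S : set R) (m : R) : is_max S m -> sup S = m.
Proof.
move=> [Sm ubm]; apply/eqP; rewrite eq_le; apply/andP; split.
  by apply: ge_sup => //; exists m.
by apply: ub_le_sup => //; exists m.
Qed.

(** * The probability simplex *)

Section Simplex.
Context {R : realType} {n : nat}.

Lemma simplex_delta (i : 'I_n) : simplex (delta_mx 0 i : 'rV[R]_n).
Proof.
split=> [j|]; first by rewrite mxE ler0n.
rewrite (bigD1 i)//= mxE !eqxx big1 ?addr0// => j /negPf ji.
by rewrite mxE ji andbF.
Qed.

(** A convex combination of [p] and a vertex, in the shape [h *: v + p] of a difference quotient. *)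
Lemma simplex_line (p : 'rV[R]_n) (h : R) i : simplex p -> 0 <= h <= 1 ->
  simplex (h *: (delta_mx 0 i - p) + p).
Proof.
move=> [p0 p1] /andP[h0 h1]; have [e0 e1] := simplex_delta i.
have E j : (h *: (delta_mx 0 i - p) + p) 0 j
    = h * (delta_mx 0 i : 'rV[R]_n) 0 j + (1 - h) * p 0 j.
  by rewrite !mxE mulrBr mulrBl mul1r addrAC addrA.
split=> [j|]; first by rewrite E addr_ge0// mulr_ge0// subr_ge0.
under eq_bigr do rewrite E.
by rewrite big_split/= -!mulr_sumr e1 p1 !mulr1 subrKC.
Qed.

(** Rules out [n = 0], where the empty sum is not 1, and supplies the starting index for the
    argmax. *)
Lemma simplex_inhabited (p : 'rV[R]_n) : simplex p -> 'I_n.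
Proof.
case: n p => [p [_ /eqP]|m _ _]; last exact: ord0.
by rewrite big_ord0 eq_sym oner_eq0.
Qed.

(** A closed subset of the unit cube: nonnegative entries summing to 1 are each at most 1. *)
Lemma compact_simplex : compact (@simplex R n).
Proof.
rewrite (_ : simplex = [set v : 'rV[R]_n | forall i, v ord0 i \in `[0, 1]]
    `&` (fun v : 'rV[R]_n => \sum_i v 0 i) @^-1` [set x | x = 1]).
  apply: compact_closedI.
    by apply: (@rV_compact _ _ (fun=> `[(0 : R), 1]%classic)) => _; exact: segment_compact.
  apply: preimage_closed; last exact: closed_eq.
  move=> v _; apply: differentiable_continuous.
  by apply: differentiable_bigsum => i _; exact: differentiable_coord.
apply/seteqP; split=> v /=; last first.
  by move=> [v01 v1]; split=> // i; have := v01 i; rewrite in_itv/= => /andP[].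
move=> [v0 v1]; split=> // i; rewrite in_itv/= v0/= -v1 (bigD1 i)//=.
by rewrite lerDl sumr_ge0.
Qed.

End Simplex.

Section Optimality.
Context {R : realType} {n d : nat}.
Variables (A : 'M[R]_(n, d)) (p : 'rV[R]_n).
Hypotheses (simplex_p : simplex p) (pd_p : pdmx (info A p)).
Local Notation lev := (leverage A p).
Local Notation V := (max_leverage A p).

Lemma is_max_leverage : is_max (range lev) V.
Proof.
pose i0 := simplex_inhabited simplex_p.
have [i _ imax] := @arg_maxP _ _ _ i0 xpredT lev isT.
have m : is_max (range lev) (lev i).
  by split; [exists i|move=> _ [j _ <-]; exact: imax].
by rewrite /max_leverage (is_max_sup m).
Qed.

Lemma le_max_leverage i : lev i <= V.
Proof. by case: is_max_leverage => _; apply; exists i. Qed.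

Lemma sum_leverage_self : \sum_i p 0 i * lev i = d%:R.
Proof. by rewrite sum_leverage mulVmx ?mxtrace1// pdmx_unit. Qed.

Lemma sum_leverage_le q : simplex q -> \sum_i q 0 i * lev i <= V.
Proof.
move=> [q0 q1]; rewrite -[leRHS]mul1r -q1 mulr_suml; apply: ler_sum => i _.
by rewrite ler_wpM2l ?le_max_leverage.
Qed.

Lemma dim_le_max_leverage : d%:R <= V.
Proof. by rewrite -sum_leverage_self sum_leverage_le. Qed.

(** The pairing is [sum_i q_i v_i - d], linear up to a constant in [q], so the maximum is attained
    at the vertex of largest leverage. *)
Lemma is_max_fw_values : is_max (fw_values A p) (V - d%:R).
Proof.
have det0 := det_pd_gt0 pd_p.
have E q : dotv (- gradient (objective A) p) (q - p)
    = \sum_i q 0 i * lev i - d%:R.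
  rewrite -sum_leverage_self -sumrB; apply: eq_bigr => i _.
  by rewrite !mxE derive_objective// opprK mulrBr ![lev i * _]mulrC.
split; last by move=> _ [q sq <-]; rewrite E lerB ?sum_leverage_le.
have [[i _ iV] _] := is_max_leverage.
exists (delta_mx 0 i); first exact: simplex_delta.
rewrite E (bigD1 i)//= mxE !eqxx mul1r iV big1 ?addr0// => j /negPf ji.
by rewrite mxE ji mul0r.
Qed.

Lemma fw_gapE : fw_gap A p = V - d%:R.
Proof. exact: is_max_sup is_max_fw_values. Qed.

Lemma fw_gap_ge0 : 0 <= fw_gap A p.
Proof. by rewrite fw_gapE subr_ge0 dim_le_max_leverage. Qed.

Lemma leverage_ge0 i : 0 <= lev i.
Proof. by have [_] := psdmx_invmx pd_p; apply. Qed.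

(* Also true for [d = 0], where both quotients are the junk value [0]. *)
Lemma leverage_mean_le q : simplex q ->
  (\sum_i q 0 i * lev i) / d%:R <= 1 + fw_gap A p / d%:R.
Proof.
move=> sq; have [d0|d0] := eqVneq (d%:R : R) 0.
  by rewrite d0 invr0 !mulr0 addr0.
rewrite fw_gapE mulrBl divff// subrKC ler_wpM2r ?invr_ge0//.
exact: sum_leverage_le.
Qed.

Lemma objective_gap_le_log q : simplex q -> 0 < \det (info A q) ->
  objective A p - objective A q <= d%:R * ln (1 + fw_gap A p / d%:R).
Proof.
move=> sq detq; have detp := det_pd_gt0 pd_p; have [q0 _] := sq.
have c0 : 0 < 1 + fw_gap A p / d%:R.
  by rewrite ltr_pwDl// divr_ge0// fw_gap_ge0.
(* After absorbing [d] as an exponent and removing [ln], the goal is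
   [\det M(q) / \det M(p) <= (1 + g/d)^d]. *)
rewrite /objective opprK addrC -ln_div// mulr_natl -lnXn// ler_ln ?posrE//.
- rewrite mulrC -det_inv (le_trans (det_mul_inv_le pd_p (psdmx_info A q0)))//.
  rewrite -sum_leverage; apply: lerXn2r (leverage_mean_le sq) => //.
  - rewrite nnegrE divr_ge0// sumr_ge0// => i _.
    by rewrite mulr_ge0// leverage_ge0.
  - by rewrite nnegrE ltW.
- by rewrite divr_gt0.
- by rewrite exprn_gt0.
Qed.

(** This is [ln (1 + x) <= x] at [x = g/d], multiplied by [d]; for [d = 0] the left side is zero. *)
Lemma log_gap_le : d%:R * ln (1 + fw_gap A p / d%:R) <= fw_gap A p.
Proof.
have g0 := fw_gap_ge0.
have [d0|d0] := posnP d; first by rewrite {1}d0 mul0r.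
have dR : 0 < d%:R :> R by rewrite ltr0n.
rewrite -ler_pdivlMl// mulrC le_ln1Dx//.
by rewrite (@lt_le_trans _ _ 0)// ?ltrN10// mulr_ge0// invr_ge0 ltW.
Qed.

Lemma ext_objectiveE q : 0 < \det (info A q) ->
  ext_objective A q = (objective A q)%:E.
Proof. by move=> detq; rewrite /ext_objective det_gt0_unit. Qed.

Lemma simplex_det_gt0 q : simplex q -> info A q \in unitmx ->
  0 < \det (info A q).
Proof.
move=> [q0 _]; rewrite unitmxE unitfE lt_def => -> /=.
exact/det_psd_ge0/psdmx_info.
Qed.

(** The extreme value theorem is applied to the determinant, continuous on the whole simplex,
    whereas the objective is infinite at singular designs. The maximum is positive because it is so
    at [p]. *)
Lemma exists_optimal : exists q, 0 < \det (info A q) /\ optimal A q.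
Proof.
have [|q|q /set_mem sq qmax] := @EVT_max_rV R n (fun q => \det (info A q))
  simplex _ compact_simplex.
- by exists p.
- apply: continuous_subspaceT => x.
  by apply: differentiable_continuous; exact: differentiable_det_info.
have detq : 0 < \det (info A q).
  by rewrite (lt_le_trans (det_pd_gt0 pd_p))// qmax// inE.
exists q; split=> //; split=> // r sr; rewrite ext_objectiveE//.
rewrite /ext_objective; case: ifPn => [/(simplex_det_gt0 sr) detr|_].
  by rewrite lee_fin lerN2 ler_ln// qmax// inE.
exact: leey.
Qed.

Lemma opt_valueE q : optimal A q -> opt_value A = ext_objective A q.
Proof.
move=> [sq qmin]; apply/eqP; rewrite eq_le; apply/andP; split.
  by apply: ereal_inf_lbound; exists q.
by apply: le_ereal_inf_tmp => _ [r sr <-]; exact: qmin.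
Qed.

Lemma max_leverage_eq_optimal : V = d%:R -> optimal A p.
Proof.
move=> Vd; split=> // q sq; rewrite ext_objectiveE ?det_pd_gt0//.
rewrite /ext_objective; case: ifPn => [/(simplex_det_gt0 sq) detq|_].
  have := objective_gap_le_log sq detq.
  by rewrite fw_gapE Vd subrr mul0r addr0 ln1 mulr0 subr_le0 lee_fin.
exact: leey.
Qed.

(** By linearity of the differential, the vertex contributes [- lev i] and [- p] contributes the
    weighted sum [d]. The slope is negative exactly when [lev i] exceeds [d]. *)
Lemma derive_objective_line i :
  'D_(delta_mx 0 i - p) (objective A) p = d%:R - lev i.
Proof.
have detp := det_pd_gt0 pd_p; have df := differentiable_objective detp.
rewrite (deriveE _ df) linearB/= -(deriveE _ df) derive_objective// addrC.
congr (_ - _); rewrite [p in 'd _ _ p]row_sum_delta linear_sum/=.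
rewrite -sum_leverage_self -sumrN; apply: eq_bigr => j _.
by rewrite linearZ/= -(deriveE _ df) derive_objective// scalerN opprK.
Qed.

Lemma optimal_max_leverage_eq : optimal A p -> V = d%:R.
Proof.
move=> [_ pmin]; apply/eqP; rewrite eq_le dim_le_max_leverage andbT.
have [[i _ <-] _] := is_max_leverage; rewrite leNgt; apply/negP => Vd.
have detp := det_pd_gt0 pd_p; set v := delta_mx 0 i - p.
have quot_lt0 : \forall h \near 0^'+,
    h^-1 *: (objective A (h *: v + p) - objective A p) < 0.
  have /cvg_dnbhs_at_right :=
    @diff_derivable _ _ _ _ _ v (differentiable_objective detp).
  rewrite -[lim _]/('D_v (objective A) p) derive_objective_line => cq.
  by apply: cvgr_lt cq _ _; rewrite subr_lt0.
have line_cvg : h *: v + p @[h --> (0 : R)^'+] --> p.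
  have l0 : h *: v + p @[h --> (0 : R)^'+] --> 0 *: v + p.
    apply: cvg_at_right_filter.
    by apply: cvgD; [exact: cvgZr_tmp|exact: cvg_cst].
  by rewrite scale0r add0r in l0.
(* A small [h > 0] keeps the point in the simplex and its determinant positive while the objective
   drops, against optimality. *)
near (0 : R)^'+ => h.
have h0 : 0 < h by [].
have h1 : h < 1 by near: h; exact: nbhs_right_lt.
have deth : 0 < \det (info A (h *: v + p)).
  by near: h; exact: line_cvg (near_det_info_gt0 detp).
have : h^-1 *: (objective A (h *: v + p) - objective A p) < 0 by near: h.
rewrite -[_ *: _]/(_ * _) pmulr_rlt0 ?invr_gt0// subr_lt0 ltNge => /negP; apply.
have sh : simplex (h *: v + p) by apply: simplex_line; rewrite ?ltW.
by have := pmin _ sh; rewrite !ext_objectiveE// lee_fin.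
Unshelve. all: by end_near. Qed.

End Optimality.

Theorem proposition2p2 (R : realType) (n d : nat) (A : 'M[R]_(n, d))
    (p : 'rV[R]_n) (rankA : \rank A = d) (simplex_p : simplex p)
    (pd_p : pdmx (info A p)) :
  (* (a) *)
  (differentiable (objective A) p /\
   (forall i : 'I_n, gradient (objective A) p 0 i = - leverage A p i)) /\
  (* (b) *)
  (\sum_i p 0 i * leverage A p i = d%:R /\
   is_max (range (leverage A p)) (max_leverage A p) /\
   d%:R <= max_leverage A p /\
   (max_leverage A p = d%:R <-> optimal A p)) /\
  (* (c) *)
  ((exists2 q : 'rV[R]_n, simplex q & ext_objective A q = opt_value A) /\
   is_max (fw_values A p) (fw_gap A p) /\
   fw_gap A p = max_leverage A p - d%:R /\
   (ext_objective A p - opt_value A <= (fw_gap A p)%:E)%E /\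
   (0 <= ext_objective A p - opt_value A)%E /\
   (ext_objective A p - opt_value A
      <= (d%:R * ln (1 + fw_gap A p / d%:R))%:E)%E /\
   d%:R * ln (1 + fw_gap A p / d%:R) <= fw_gap A p /\
   (forall eps : R,
      max_leverage A p <= (1 + eps) * d%:R <-> fw_gap A p <= eps * d%:R)) /\
  (* (d) *)
  ((\forall q \near p, differentiable (objective A) q) /\
   differentiable (gradient (objective A)) p /\
   (forall i j : 'I_n,
      hessian (objective A) p i j
      = ((design_row A i)^T *m invmx (info A p) *m design_row A j) 0 0 ^+ 2) /\
   (forall i j : 'I_n,
      hessian (objective A) p i j = trdot (whitened A p i) (whitened A p j)) /\
   psdmx (hessian (objective A) p) /\
   (\rank (hessian (objective A) p) <= 'C(d.+1, 2))%N /\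
   hessian_kernel A p
     = [set delta : 'rV[R]_n |
         \sum_i delta 0 i *: (design_row A i *m (design_row A i)^T) = 0] /\
   (forall q : 'rV[R]_n, simplex q -> pdmx (info A q) ->
      hessian_kernel A q = hessian_kernel A p) /\
   (forall delta : 'rV[R]_n,
      (delta *m hessian (objective A) p *m delta^T) 0 0
      = frobnorm (invsqrtmx (info A p)
                  *m (\sum_i delta 0 i *:
                        (design_row A i *m (design_row A i)^T))
                  *m invsqrtmx (info A p)) ^+ 2)).
Proof.
have detp := det_pd_gt0 pd_p.
have kerE := hessian_kernelE.
split; [split; [exact: differentiable_objective|]|split; [|split]].
- by move=> i; rewrite mxE derive_objective.
- split; first exact: sum_leverage_self.
  split; first exact: is_max_leverage.
  split; first exact: dim_le_max_leverage.
  by split; [exact: max_leverage_eq_optimal|exact: optimal_max_leverage_eq].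
- have [q [detq optq]] := exists_optimal simplex_p pd_p; have [sq qmin] := optq.
  have gap_log := objective_gap_le_log simplex_p pd_p sq detq.
  have log_gap := log_gap_le simplex_p pd_p.
  have optE := opt_valueE optq.
  split; first by exists q.
  split; first by rewrite fw_gapE//; exact: is_max_fw_values.
  split; first exact: fw_gapE.
  (* Both values are finite, so the extended inequalities become real ones at the minimizer [q]. *)
  rewrite optE !ext_objectiveE// -EFinB !lee_fin.
  split; first exact: le_trans gap_log log_gap.
  split; first by have := qmin _ simplex_p; rewrite !ext_objectiveE// lee_fin subr_ge0.
  split=> //; split=> // eps.
  by rewrite fw_gapE// mulrDl mul1r lerBlDl.
split; first exact: filterS (@differentiable_objective _ _ _ A) (near_det_info_gt0 detp).
split; first exact: differentiable_gradient_objective.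
split; first by move=> i j; exact: hessian_objective.
split; first by move=> i j; rewrite hessian_gram// mxE.
split; first exact: psdmx_hessian.
split; first by rewrite hessian_gram//; apply: mxrank_sym_gram => i; exact: tr_whitened.
split; first exact: kerE.
(* The description of the kernel does not mention the design, hence its independence of [p]. *)
split; first by move=> q _ pd_q; rewrite !kerE.
by move=> delta; exact: hessian_quadratic.
Qed.
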